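(* Let $\omega\in[0,1]$ and let $A\in\mathbb{C}^{m\times m}$, $B\in\mathbb{C}^{m\times n}$, $C\in\mathbb{C}^{n\times m}$, $D\in\mathbb{C}^{n\times n}$ be such that $XCX-XD-AX+B=0$ is in class $\mathbb{H}^\omega$, and suppose that $Q_\omega\mathbf{1}>0$, where $Q=\begin{pmatrix}D&-C\\-B&A\end{pmatrix}$. Let $\Phi$ and $\Psi$ be the extremal solutions of $XCX-XD-AX+B=0$ and of its dual $YBY-YA-DY+C=0$, respectively. Let $\{E_k\},\{F_k\},\{G_k\},\{H_k\}$ be generated by SDA applied to $XCX-XD-AX+B=0$ with a complex parameter $\alpha$ such that $\omega\,\mathrm{Re}(\alpha)+(1-\omega)\,\mathrm{Im}(\alpha)>0$ and $$\frac{\omega\,\mathrm{Re}(\alpha)+(1-\omega)\,\mathrm{Im}(\alpha)+q_i}{|\alpha+[Q]_{ii}|}\,|\alpha-[Q]_{ii}|<\omega\,\mathrm{Re}(\alpha)+(1-\omega)\,\mathrm{Im}(\alpha)-q_i,\quad i=1,\dots,m+n,$$ where $q_i=\sum_{j\ne i}|[Q]_{ij}|$. Then the sequences $\{H_k\}$ and $\{G_k\}$ converge quadratically to $\Phi$ and $\Psi$, respectively.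
   Context: For a complex square matrix $M$ and a real $\omega\in[0,1]$, the $\omega$-comparison matrix $M_\omega$ is the real matrix with entries $[M_\omega]_{ii}=\omega\,\mathrm{Re}([M]_{ii})+(1-\omega)\,\mathrm{Im}([M]_{ii})$ and $[M_\omega]_{ij}=-|[M]_{ij}|$ for $i\ne j$. A real square matrix $M$ is a nonsingular M-matrix if all its off-diagonal entries are nonpositive and $Mu>0$ (entrywise) for some vector $u>0$. $\mathbf{1}$ is the all-ones column vector. The equation is in class $\mathbb{H}^\omega$ if $Q_\omega$ is a nonsingular M-matrix. Extremal solutions: $\Phi$ is the unique solution of $XCX-XD-AX+B=0$ such that every eigenvalue $\lambda$ of $D-C\Phi$ satisfies $\omega\,\mathrm{Re}(\lambda)+(1-\omega)\,\mathrm{Im}(\lambda)>0$; $\Psi$ is the unique solution of $YBY-YA-DY+C=0$ such that every eigenvalue $\lambda$ of $A-B\Psi$ satisfies the same inequality (both exist and are unique under these hypotheses). SDA with parameter $\alpha$ is the following algorithm with $\beta=\alpha$: put $A_\beta=A+\beta I$, $D_\alpha=D+\alpha I$, $W_{\alpha\beta}=A_\beta-BD_\alpha^{-1}C$, $V_{\alpha\beta}=D_\alpha-CA_\beta^{-1}B$, and $$E_0=I-(\alpha+\beta)V_{\alpha\beta}^{-1},\ F_0=I-(\alpha+\beta)W_{\alpha\beta}^{-1},\ G_0=(\alpha+\beta)D_\alpha^{-1}CW_{\alpha\beta}^{-1},\ H_0=(\alpha+\beta)W_{\alpha\beta}^{-1}BD_\alpha^{-1};$$ for $k\ge0$, $$E_{k+1}=E_k(I-G_kH_k)^{-1}E_k,\quad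 F_{k+1}=F_k(I-H_kG_k)^{-1}F_k,$$ $$G_{k+1}=G_k+E_k(I-G_kH_k)^{-1}G_kF_k,\quad H_{k+1}=H_k+F_k(I-H_kG_k)^{-1}H_kE_k.$$ Quadratic convergence of the doubling algorithm means $\limsup_{k\to\infty}\|H_k-\Phi\|^{1/2^k}<1$ and $\limsup_{k\to\infty}\|G_k-\Psi\|^{1/2^k}<1$. *)

(* Defs.v *)
From HB Require Import structures.
From mathcomp Require Import all_boot all_order all_algebra.
From mathcomp Require Import all_classical all_reals all_analysis.
From mathcomp Require Import complex.

Set Implicit Arguments.
Unset Strict Implicit.
Unset Printing Implicit Defensive.

Import Order.TTheory GRing.Theory Num.Theory.
Import numFieldNormedType.Exports.

Local Open Scope ring_scope.
Local Open Scope complex_scope.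

(* The R-valued modulus; `|z| would be an element of R[i]. *)
Definition cabs (R : realType) (z : R[i]) : R := Normc.normc z.

Definition omega_part (R : realType) (w : R) (z : R[i]) : R :=
  w * complex.Re z + (1 - w) * complex.Im z.

Definition omega_comparison (R : realType) (p : nat) (w : R)
    (M : 'M[R[i]]_p) : 'M[R]_p :=
  \matrix_(i, j) if i == j then omega_part w (M i i) else - cabs (M i j).

Definition pos_colvec (R : realType) (p : nat) (u : 'cV[R]_p) : Prop :=
  forall i, 0 < u i 0.

Definition nonsingular_Mmatrix (R : realType) (p : nat) (M : 'M[R]_p) : Prop :=
  (forall i j, i != j -> M i j <= 0) /\
  exists2 u : 'cV[R]_p, pos_colvec u & pos_colvec (M *m u).

Definition coeff_mx (R : realType) (m n : nat)
    (A : 'M[R[i]]_m) (B : 'M[R[i]]_(m, n)) (C : 'M[R[i]]_(n, m))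
    (D : 'M[R[i]]_n) : 'M[R[i]]_(n + m) :=
  block_mx D (- C) (- B) A.

Definition class_H (R : realType) (m n : nat) (w : R)
    (A : 'M[R[i]]_m) (B : 'M[R[i]]_(m, n)) (C : 'M[R[i]]_(n, m))
    (D : 'M[R[i]]_n) : Prop :=
  nonsingular_Mmatrix (omega_comparison w (coeff_mx A B C D)).

Definition offdiag_sum (R : realType) (p : nat) (M : 'M[R[i]]_p) (i : 'I_p) : R :=
  \sum_(j | j != i) cabs (M i j).

(* The dual equation Y B Y - Y A - D Y + C = 0 with its spectral condition on
   A - B Y is obtained by exchanging (A, B) with (D, C). *)
Definition riccati_solution (R : realType) (m n : nat)
    (A : 'M[R[i]]_m) (B : 'M[R[i]]_(m, n)) (C : 'M[R[i]]_(n, m))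
    (D : 'M[R[i]]_n) (X : 'M[R[i]]_(m, n)) : Prop :=
  X *m C *m X - X *m D - A *m X + B = 0.

Definition extremal_solution (R : realType) (m n : nat) (w : R)
    (A : 'M[R[i]]_m) (B : 'M[R[i]]_(m, n)) (C : 'M[R[i]]_(n, m))
    (D : 'M[R[i]]_n) (X : 'M[R[i]]_(m, n)) : Prop :=
  riccati_solution A B C D X /\
  forall l : R[i], eigenvalue (D - C *m X) l -> 0 < omega_part w l.

Record sda_state (R : realType) (m n : nat) := SdaState {
  sdaE : 'M[R[i]]_n;
  sdaF : 'M[R[i]]_m;
  sdaG : 'M[R[i]]_(n, m);
  sdaH : 'M[R[i]]_(m, n)
}.

Definition shift_mx (R : realType) (p : nat) (M : 'M[R[i]]_p) (a : R[i]) :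
    'M[R[i]]_p := M + a%:M.

Definition sda_W (R : realType) (m n : nat)
    (A : 'M[R[i]]_m) (B : 'M[R[i]]_(m, n)) (C : 'M[R[i]]_(n, m))
    (D : 'M[R[i]]_n) (a b : R[i]) : 'M[R[i]]_m :=
  shift_mx A b - B *m invmx (shift_mx D a) *m C.

Definition sda_V (R : realType) (m n : nat)
    (A : 'M[R[i]]_m) (B : 'M[R[i]]_(m, n)) (C : 'M[R[i]]_(n, m))
    (D : 'M[R[i]]_n) (a b : R[i]) : 'M[R[i]]_n :=
  shift_mx D a - C *m invmx (shift_mx A b) *m B.

Definition sda_init (R : realType) (m n : nat)
    (A : 'M[R[i]]_m) (B : 'M[R[i]]_(m, n)) (C : 'M[R[i]]_(n, m))
    (D : 'M[R[i]]_n) (a b : R[i]) : sda_state R m n :=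
  let Da' := invmx (shift_mx D a) in
  let W' := invmx (sda_W A B C D a b) in
  let V' := invmx (sda_V A B C D a b) in
  {| sdaE := 1%:M - (a + b) *: V';
     sdaF := 1%:M - (a + b) *: W';
     sdaG := (a + b) *: (Da' *m C *m W');
     sdaH := (a + b) *: (W' *m B *m Da') |}.

Definition sda_step (R : realType) (m n : nat) (s : sda_state R m n) :
    sda_state R m n :=
  let: SdaState E F G H := s in
  let K := invmx (1%:M - G *m H) in
  let L := invmx (1%:M - H *m G) in
  {| sdaE := E *m K *m E;
     sdaF := F *m L *m F;
     sdaG := G + E *m K *m G *m F;
     sdaH := H + F *m L *m H *m E |}.

Definition doubling (R : realType) (m n : nat)
    (A : 'M[R[i]]_m) (B : 'M[R[i]]_(m, n)) (C : 'M[R[i]]_(n, m))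
    (D : 'M[R[i]]_n) (a b : R[i]) (k : nat) : sda_state R m n :=
  iter k (@sda_step R m n) (sda_init A B C D a b).

Definition sda (R : realType) (m n : nat)
    (A : 'M[R[i]]_m) (B : 'M[R[i]]_(m, n)) (C : 'M[R[i]]_(n, m))
    (D : 'M[R[i]]_n) (a : R[i]) (k : nat) : sda_state R m n :=
  doubling A B C D a a k.

(* invmx is total (invmx M = M when M is singular), so the fact that every
   inverse taken by the algorithm is a genuine one has to be stated. *)
Definition sda_well_defined (R : realType) (m n : nat)
    (A : 'M[R[i]]_m) (B : 'M[R[i]]_(m, n)) (C : 'M[R[i]]_(n, m))
    (D : 'M[R[i]]_n) (a : R[i]) : Prop :=
  [/\ shift_mx A a \in unitmx, shift_mx D a \in unitmx,
      sda_W A B C D a a \in unitmx, sda_V A B C D a a \in unitmx &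
      forall k, let s := sda A B C D a k in
        1%:M - sdaG s *m sdaH s \in unitmx /\
        1%:M - sdaH s *m sdaG s \in unitmx].

(* Largest modulus of an entry. The condition limsup < 1 below does not depend
   on the choice of the matrix norm. *)
Definition cmx_norm (R : realType) (p q : nat) (M : 'M[R[i]]_(p, q)) : R :=
  mx_norm (map_mx (@cabs R) M).

(* The limsup is taken in \bar R, where it exists for every sequence. *)
Definition quadratic_cvg (R : realType) (p q : nat)
    (U : nat -> 'M[R[i]]_(p, q)) (L : 'M[R[i]]_(p, q)) : Prop :=
  (limn_esup (fun k : nat => (cmx_norm (U k - L)%R `^ (2 ^+ k)^-1)%:E)
     < 1%:E)%E.

(* Main.v *)
Require Import Defs.
From HB Require Import structures.
From mathcomp Require Import all_boot all_order all_algebra.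
From mathcomp Require Import all_classical all_reals all_analysis.
From mathcomp Require Import complex.
From mathcomp Require Import ring lra.

(** The algorithm is read as the composition of scattering cells.  A state
    [(E, F, G, H)] couples left data [(x1, y1)] to right data [(x2, y2)] by
    [x2 = E x1 + G y2] and [y1 = H x1 + F y2], and one doubling step produces
    exactly the cell obtained by gluing two copies of the current one
    ([cell_step]); hence the k-th state is a chain of [2 ^ k] initial cells.

    The initial cell is the Cayley transform [(Q + a)^-1 (Q - a)] of the
    coefficient matrix, up to signs ([init_cell_cayley]).  Since
    [|a + Q_ii| + |a - Q_ii| >= 2 omega(a)], the condition on the parameter
    gives [|a - Q_ii| + 2 q_i < |a + Q_ii|] ([parameter_cayley_dominant]), and
    looking at an entry of maximal modulus shows that this transform has
    row-sum norm at most some [rho < 1] ([cayley_contraction]).  If the data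
    entering a cell on the right are at most [rho] times those leaving it
    there, then the signal going right shrinks by [rho] through the cell and
    what is reflected on the left is again at most [rho] times what was sent
    in ([contractive_forward]).  This property is inherited by chains, so
    [|E_k|, |F_k| <= rho ^ (2 ^ k)] and [|G_k|, |H_k| <= rho]
    ([iter_forward]), which also makes every [I - G_k H_k] invertible.

    Put [S = D - C Phi] and [T = (S + a)^-1 (S - a)].  The graph of [Phi] is
    invariant: [(x, Phi x)] and [(T x, Phi T x)] are the two sides of an
    initial cell ([closed_loop_cell]), so the chain of length [2 ^ k] yields
    [Phi - H_k = F_k Phi T ^ (2 ^ k)].  It remains to see that the powers of
    [T] are bounded, and for this that its eigenvalues have modulus less than
    one ([closed_loop_eigenvalue]).  An eigenvector [x] of [T] is one of [S],
    with an eigenvalue of positive omega-part; the dominance of the omega-parts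
    of the diagonal of [Q] forbids the largest entry of [(x, Phi x)] to lie in
    [Phi x] ([argmax_omega_lt0]), so [|Phi x| <= |x|], and the contraction
    property of the initial cell then excludes an eigenvalue of modulus at
    least one.  Therefore [|H_k - Phi| <= K rho ^ (2 ^ k)].  Exchanging
    [(A, B)] with [(D, C)] turns the cells around, which gives the claim for
    [G_k] and [Psi]. *)

Set Implicit Arguments.
Unset Strict Implicit.
Unset Printing Implicit Defensive.

Import Order.TTheory GRing.Theory Num.Theory.
Import numFieldNormedType.Exports.

Local Open Scope ring_scope.
Local Open Scope complex_scope.

(** * Modulus and omega-part of complex numbers *)

Section Modulus.
Variable R : realType.
Implicit Types x y z : R[i].

Lemma cabs_normE z : `|z| = (cabs z)%:C.
Proof. by rewrite normc_def /cabs /Normc.normc; case: z. Qed.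

Lemma cabs_ge0 z : 0 <= cabs z.
Proof. by rewrite -lecR -cabs_normE normr_ge0. Qed.

Lemma cabs0 : cabs (0 : R[i]) = 0.
Proof. exact: Normc.normc0. Qed.

Lemma cabsM x y : cabs (x * y) = cabs x * cabs y.
Proof. exact: Normc.normcM. Qed.

Lemma cabsN x : cabs (- x) = cabs x.
Proof. exact: (@normcN R x). Qed.

Lemma cabsD x y : cabs (x + y) <= cabs x + cabs y.
Proof. exact: (@le_normcD R x y). Qed.

Lemma cabsB x y : cabs (x - y) <= cabs x + cabs y.
Proof. by rewrite -(cabsN y) cabsD. Qed.

Lemma cabs_eq0 z : (cabs z == 0) = (z == 0).
Proof.
by apply/eqP/eqP => [/Normc.eq0_normc // | ->]; rewrite cabs0.
Qed.

Lemma cabs_sum (I : Type) (r : seq I) (P : pred I) (F : I -> R[i]) :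
  cabs (\sum_(i <- r | P i) F i) <= \sum_(i <- r | P i) cabs (F i).
Proof.
elim/big_rec2: _ => [|i y z _ le_yz]; first by rewrite cabs0.
by rewrite (le_trans (cabsD _ _))// lerD2l.
Qed.

Lemma Re_le_cabs z : `|complex.Re z| <= cabs z.
Proof. by rewrite -lecR -cabs_normE normc_ge_Re. Qed.

Lemma Im_le_cabs z : `|complex.Im z| <= cabs z.
Proof.
by case: z => a b /=; rewrite -sqrtr_sqr ler_wsqrtr// lerDr sqr_ge0.
Qed.

Lemma omega_partD w x y :
  omega_part w (x + y) = omega_part w x + omega_part w y.
Proof. by case: x y => [a b] [c d]; rewrite /omega_part /=; ring. Qed.

Lemma omega_part_le_cabs w z : 0 <= w -> w <= 1 -> omega_part w z <= cabs z.
Proof.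
move=> w0 w1; have := Re_le_cabs z; have := Im_le_cabs z.
have := ler_norm (complex.Re z); have := ler_norm (complex.Im z).
rewrite /omega_part; nra.
Qed.

End Modulus.

(** * The maximal modulus of the entries of a matrix *)

Section SupNorm.
Variable R : realType.

Lemma cmx_norm_ge0 p q (M : 'M[R[i]]_(p, q)) : 0 <= cmx_norm M.
Proof. by rewrite /cmx_norm mx_normrE; exact: bigmax_ge_id. Qed.

Lemma cabs_le_cmx_norm p q (M : 'M[R[i]]_(p, q)) i j :
  cabs (M i j) <= cmx_norm M.
Proof.
rewrite /cmx_norm mx_normrE.
have := @le_bigmax _ _ _ (0 : R)
  (fun ij : 'I_p * 'I_q => `|map_mx (@cabs R) M ij.1 ij.2|) (i, j).
by rewrite /= mxE ger0_norm ?cabs_ge0.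
Qed.

Lemma cmx_norm_le p q (M : 'M[R[i]]_(p, q)) r :
  0 <= r -> (forall i j, cabs (M i j) <= r) -> cmx_norm M <= r.
Proof.
move=> r0 Mr; rewrite /cmx_norm mx_normrE; apply: bigmax_le => // ij _.
by rewrite mxE ger0_norm ?cabs_ge0.
Qed.

Lemma cmx_norm0 p q : cmx_norm (0 : 'M[R[i]]_(p, q)) = 0.
Proof.
apply/eqP; rewrite eq_le cmx_norm_ge0 andbT.
by apply: cmx_norm_le => // i j; rewrite mxE cabs0.
Qed.

Lemma cmx_norm_le0 p q (M : 'M[R[i]]_(p, q)) : cmx_norm M <= 0 -> M = 0.
Proof.
move=> M0; apply/matrixP => i j; rewrite mxE; apply/eqP; rewrite -cabs_eq0.
by rewrite eq_le cabs_ge0 andbT (le_trans _ M0)// cabs_le_cmx_norm.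
Qed.

Lemma cmx_normD p q (M N : 'M[R[i]]_(p, q)) :
  cmx_norm (M + N) <= cmx_norm M + cmx_norm N.
Proof.
apply: cmx_norm_le => [|i j]; first by rewrite addr_ge0 ?cmx_norm_ge0.
by rewrite mxE (le_trans (cabsD _ _))// lerD ?cabs_le_cmx_norm.
Qed.

Lemma cmx_normZ p q a (M : 'M[R[i]]_(p, q)) :
  cmx_norm (a *: M) = cabs a * cmx_norm M.
Proof.
apply/eqP; rewrite eq_le; apply/andP; split.
  apply: cmx_norm_le => [|i j].
    by rewrite mulr_ge0 ?cabs_ge0 ?cmx_norm_ge0.
  by rewrite mxE cabsM ler_wpM2l ?cabs_ge0 ?cabs_le_cmx_norm.
have [->|a0] := eqVneq a 0; first by rewrite cabs0 mul0r cmx_norm_ge0.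
have pa : 0 < cabs a by rewrite lt0r cabs_eq0 a0 cabs_ge0.
rewrite -ler_pdivlMl//; apply: cmx_norm_le => [|i j].
  by rewrite mulr_ge0 ?invr_ge0 ?cabs_ge0 ?cmx_norm_ge0.
rewrite ler_pdivlMl// -cabsM; have := cabs_le_cmx_norm (a *: M) i j.
by rewrite mxE.
Qed.

Lemma cmx_normN p q (M : 'M[R[i]]_(p, q)) : cmx_norm (- M) = cmx_norm M.
Proof.
by congr mx_norm; apply/matrixP => i j; rewrite !mxE cabsN.
Qed.

Lemma cmx_normM p q r (M : 'M[R[i]]_(p, q)) (N : 'M[R[i]]_(q, r)) :
  cmx_norm (M *m N) <= q%:R * cmx_norm M * cmx_norm N.
Proof.
apply: cmx_norm_le => [|i j]; first by rewrite !mulr_ge0 ?cmx_norm_ge0.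
rewrite mxE (le_trans (cabs_sum _ _ _))//.
rewrite -mulrA mulr_natl.
have -> : cmx_norm M * cmx_norm N *+ q = \sum_(k < q) cmx_norm M * cmx_norm N.
  by rewrite sumr_const card_ord.
apply: ler_sum => k _.
by rewrite cabsM ler_pM ?cabs_ge0 ?cabs_le_cmx_norm.
Qed.

Lemma cmx_norm_col p1 p2 q (M : 'M[R[i]]_(p1, q)) (N : 'M[R[i]]_(p2, q)) :
  cmx_norm (col_mx M N) = Num.max (cmx_norm M) (cmx_norm N).
Proof.
apply/eqP; rewrite eq_le; apply/andP; split.
  apply: cmx_norm_le => [|i j]; first by rewrite le_max cmx_norm_ge0.
  by rewrite mxE le_max; case: splitP => k _; rewrite cabs_le_cmx_norm ?orbT.
rewrite ge_max; apply/andP; split; apply: cmx_norm_le => [|i j];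
  rewrite ?cmx_norm_ge0//.
- by have := cabs_le_cmx_norm (col_mx M N) (lshift _ i) j; rewrite col_mxEu.
- by have := cabs_le_cmx_norm (col_mx M N) (rshift _ i) j; rewrite col_mxEd.
Qed.

End SupNorm.

(** * Eigenvalues and bounded powers *)

Section Eigen.
Variable F : fieldType.

Lemma unitmx_inj n (M : 'M[F]_n) :
  (forall x : 'cV[F]_n, M *m x = 0 -> x = 0) -> M \in unitmx.
Proof.
move=> injM; rewrite -unitmx_tr -row_free_unit; apply: inj_row_free => v vM0.
apply: trmx_inj; rewrite trmx0; apply: injM.
by rewrite -[M]trmxK -trmx_mul vM0 trmx0.
Qed.

(** [eigenvalue] is defined by row vectors, whereas the Riccati equation acts on
    columns. *)
Lemma eigenvalue_colP n (M : 'M[F]_n) a :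
  reflect (exists2 x : 'cV[F]_n, M *m x = a *: x & x != 0) (eigenvalue M a).
Proof.
have -> : eigenvalue M a = eigenvalue M^T a.
  rewrite !eigenvalue_root_char; congr (root _ a).
  rewrite /char_poly -det_tr; congr (\det _).
  by apply/matrixP => i j; rewrite !mxE eq_sym.
apply: (iffP eigenvalueP) => -[x Mx x0].
  exists x^T; last by rewrite -trmx0 (inj_eq trmx_inj).
  by rewrite -[M in LHS]trmxK -trmx_mul Mx linearZ.
exists x^T; last by rewrite -trmx0 (inj_eq trmx_inj).
by rewrite -trmx_mul Mx linearZ.
Qed.

End Eigen.

Lemma recur_bounded (R : realType) (r K : R) (u : nat -> R) :
  0 <= r -> r < 1 -> (forall k, u k.+1 <= r * u k + K) ->
  exists K', forall k, u k <= K'.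
Proof.
move=> r0 r1 uS; exists (Num.max (u 0%N) (K / (1 - r))).
have r1' : 0 < 1 - r by rewrite subr_gt0.
elim=> [|k IH]; first by rewrite le_max lexx.
set L := Num.max _ _ in IH *.
have : K / (1 - r) <= L by rewrite /L le_max lexx orbT.
rewrite ler_pdivrMr// => KL.
have := uS k; nra.
Qed.

(** By Cayley-Hamilton a product of factors [T - z] with [|z| < 1] kills every
    matrix.  Removing one factor at a time, [u_k = |T ^ k X|] satisfies
    [u_(k+1) <= |z| u_k + K], where [K] bounds the sequence attached to
    [(T - z) X], which is killed by the remaining factors. *)
Lemma expmx_bounded (R : realType) n (T : 'M[R[i]]_n) :
  (forall z, eigenvalue T z -> cabs z < 1) ->
  exists K, forall k, cmx_norm (T ^+ k) <= K.
Proof.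
case: n T => [|n] T eigT.
  by exists 0 => k; apply: cmx_norm_le => // -[].
have [s Ds] := closed_field_poly_normal (char_poly T).
rewrite (monicP (char_poly_monic T)) scale1r in Ds.
have {}eigT : all (fun z => cabs z < 1) s.
  apply/allP => z zs; apply: eigT.
  by rewrite eigenvalue_root_char Ds root_prod_XsubC.
suff [K HK] : exists K, forall k, cmx_norm (T ^+ k * 1) <= K.
  by exists K => k; rewrite -[T ^+ k](mulr1 (_ : 'M[R[i]]_n.+1)).
have : horner_mx T (\prod_(z <- s) ('X - z%:P)) * 1 = 0.
  by rewrite -Ds Cayley_Hamilton mul0r.
move: (1 : 'M[R[i]]_n.+1) => X {Ds}.
elim: s eigT X => [|z s IH] /= eigT X.
  rewrite big_nil rmorph1 mul1r => ->.
  by exists 0 => k; rewrite mulr0 cmx_norm0.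
case/andP: eigT => z1 /IH {}IH.
rewrite big_cons mulrC rmorphM /= -mulrA => /IH [K HK].
apply: (@recur_bounded R (cabs z) K); rewrite ?cabs_ge0// => k.
rewrite -cmx_normZ.
have -> : T ^+ k.+1 * X = z *: (T ^+ k * X)
    + T ^+ k * (horner_mx T ('X - z%:P) * X).
  rewrite rmorphB /= horner_mx_X horner_mx_C mulrBl mulrBr exprSr -mulrA.
  have -> : z%:M * X = z *: X by exact: mul_scalar_mx.
  by rewrite -scalerAr addrC subrK.
by rewrite (le_trans (cmx_normD _ _))// lerD2l.
Qed.

(** * Doubling as composition of cells *)

Section Cells.
Variable R : realType.

(** The number [p] of columns is left free so that a cell can be applied to
    vectors as well as to whole matrices such as [1] and [Phi]. *)
Definition cell m n (s : sda_state R m n) p (x1 : 'M[R[i]]_(n, p))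
    (y1 : 'M[R[i]]_(m, p)) (x2 : 'M[R[i]]_(n, p)) (y2 : 'M[R[i]]_(m, p)) :=
  x2 = sdaE s *m x1 + sdaG s *m y2 /\ y1 = sdaH s *m x1 + sdaF s *m y2.

(** The cell seen in a mirror; it reduces the statements on [F] and [G] to
    those on [E] and [H]. *)
Definition swap_state m n (s : sda_state R m n) : sda_state R n m :=
  SdaState (sdaF s) (sdaE s) (sdaH s) (sdaG s).

Lemma cell_swap m n (s : sda_state R m n) p x1 y1 x2 y2 :
  @cell _ _ s p x1 y1 x2 y2 -> cell (swap_state s) y2 x2 y1 x1.
Proof. by case=> -> ->; split; rewrite /= addrC. Qed.

Lemma sda_step_swap m n (s : sda_state R m n) :
  sda_step (swap_state s) = swap_state (sda_step s).
Proof. by case: s. Qed.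

Definition step_solvable m n (s : sda_state R m n) :=
  1%:M - sdaG s *m sdaH s \in unitmx /\ 1%:M - sdaH s *m sdaG s \in unitmx.

(** Eliminating the inner data [(x1, y1)] needs precisely the two inverses taken
    by the algorithm. *)
Lemma cell_step m n (s : sda_state R m n) p x0 y0 x1 y1 x2 y2 :
  step_solvable s ->
  cell s x0 y0 x1 y1 -> cell s x1 y1 x2 y2 ->
  @cell _ _ (sda_step s) p x0 y0 x2 y2.
Proof.
case: s => E F G H [/= uK uL] [/= Dx1 Dy0] [/= Dx2 Dy1].
have Dx1' : x1 = invmx (1%:M - G *m H) *m (E *m x0 + G *m F *m y2).
  apply: (canRL (mulKmx uK)).
  rewrite mulmxBl mul1mx {1}Dx1 Dy1 mulmxDr -!mulmxA -addrA.
  by rewrite (addrC (G *m (H *m x1))) addrK.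
have Dy1' : y1 = invmx (1%:M - H *m G) *m (F *m y2 + H *m E *m x0).
  apply: (canRL (mulKmx uL)).
  rewrite mulmxBl mul1mx {1}Dy1 Dx1 mulmxDr -!mulmxA.
  by rewrite addrAC addrK addrC.
split => /=; [rewrite Dx2 Dx1'|rewrite Dy0 Dy1'].
  by rewrite !(mulmxDl, mulmxDr) !mulmxA -!addrA; congr (_ + _); rewrite addrC.
by rewrite !(mulmxDl, mulmxDr) !mulmxA -!addrA; congr (_ + _); rewrite addrC.
Qed.

(** Conversely, any outer data arise from two glued cells. *)
Lemma cell_split m n (s : sda_state R m n) p
    (x0 : 'M[R[i]]_(n, p)) (y2 : 'M[R[i]]_(m, p)) :
  step_solvable s ->
  exists x1 y1, cell s x0 (sdaH s *m x0 + sdaF s *m y1) x1 y1 /\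
                cell s x1 y1 (sdaE s *m x1 + sdaG s *m y2) y2.
Proof.
case: s => E F G H [/= uK uL].
pose x1 := invmx (1%:M - G *m H) *m (E *m x0 + G *m F *m y2).
exists x1, (H *m x1 + F *m y2); split; last by split.
split=> //=; have := mulKVmx uK (E *m x0 + G *m F *m y2); rewrite -/x1.
rewrite mulmxBl mul1mx => /(canRL (subrK _)) {1}->.
by rewrite mulmxDr !mulmxA -addrA [G *m F *m _ + _]addrC.
Qed.

Definition contractive (rho : R) m n (s : sda_state R m n) :=
  forall p x1 y1 x2 y2, @cell _ _ s p x1 y1 x2 y2 ->
    Num.max (cmx_norm x2) (cmx_norm y1)
      <= rho * Num.max (cmx_norm x1) (cmx_norm y2).

(** Unlike [contractive], whose constant would stay [rho] along the doubling,
    this property composes with multiplication of the transmission rate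
    [sigma], while the reflection rate [rho] is reproduced. *)
Definition forward (rho sigma : R) m n (s : sda_state R m n) :=
  forall p x1 y1 x2 y2, @cell _ _ s p x1 y1 x2 y2 ->
    cmx_norm y2 <= rho * cmx_norm x2 ->
    cmx_norm x2 <= sigma * cmx_norm x1 /\ cmx_norm y1 <= rho * cmx_norm x1.

Lemma contractive_swap rho m n (s : sda_state R m n) :
  contractive rho s -> contractive rho (swap_state s).
Proof.
move=> cs p x1 y1 x2 y2 /cell_swap; case: s cs => E F G H cs /cs.
by rewrite maxC [X in _ <= _ * X]maxC.
Qed.

Lemma contracted_twice_le0 (r x : R) :
  0 <= r -> r < 1 -> 0 <= x -> x <= r * (r * x) -> x <= 0.
Proof. by move=> r0 r1 x0; have := mulr_ge0 r0 x0; nra. Qed.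

(** If the maximum on the right of [contractive] were [|y2| > |x1|], then
    [|y2| <= rho |x2| <= rho^2 |y2|] would force [y2 = 0]; so it is [|x1|]. *)
Lemma contractive_forward rho m n (s : sda_state R m n) :
  0 <= rho -> rho < 1 -> contractive rho s -> forward rho rho s.
Proof.
move=> r0 r1 cs p x1 y1 x2 y2 /cs.
have x1_ge0 := cmx_norm_ge0 x1; have y2_ge0 := cmx_norm_ge0 y2.
rewrite ge_max => /andP[].
case: (leP (cmx_norm x1) (cmx_norm y2)) => [le_x1 le_x2 le_y1 le_y2 | //].
have y2_eq0 : cmx_norm y2 <= 0.
  have : cmx_norm y2 <= rho * (rho * cmx_norm y2).
    by rewrite (le_trans le_y2)// ler_wpM2l.
  exact: contracted_twice_le0.
by split; nra.
Qed.

Lemma forward_decay rho sigma m n (s : sda_state R m n) p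
    (x : 'M[R[i]]_(n, p)) :
  0 <= rho -> forward rho sigma s ->
  cmx_norm (sdaE s *m x) <= sigma * cmx_norm x /\
  cmx_norm (sdaH s *m x) <= rho * cmx_norm x.
Proof.
move=> r0 /(_ p x _ _ 0 (conj erefl erefl)).
by rewrite !mulmx0 !addr0 cmx_norm0; apply; rewrite mulr_ge0 ?cmx_norm_ge0.
Qed.

(** [x = G H x] gives [|x| <= rho^2 |x|]. *)
Lemma forward_unit rho sigma m n (s : sda_state R m n) :
  0 <= rho -> rho < 1 ->
  forward rho sigma s -> forward rho sigma (swap_state s) ->
  1%:M - sdaG s *m sdaH s \in unitmx.
Proof.
move=> r0 r1 fs fs'; apply: unitmx_inj => x /eqP.
rewrite mulmxBl mul1mx subr_eq0 -mulmxA => /eqP Dx.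
have [_ Hx] := forward_decay x r0 fs.
have [_ /=] := forward_decay (sdaH s *m x) r0 fs'; rewrite -Dx => Gx.
apply/cmx_norm_le0/(contracted_twice_le0 r0 r1 (cmx_norm_ge0 x)).
by rewrite (le_trans Gx)// ler_wpM2l.
Qed.

Lemma forward_solvable rho sigma m n (s : sda_state R m n) :
  0 <= rho -> rho < 1 ->
  forward rho sigma s -> forward rho sigma (swap_state s) -> step_solvable s.
Proof.
move=> r0 r1 fs fs'; split; first exact: forward_unit fs fs'.
by apply: (forward_unit r0 r1 fs'); case: s fs {fs'}.
Qed.

Lemma forward_step rho sigma m n (s : sda_state R m n) :
  0 <= rho -> 0 <= sigma -> step_solvable s ->
  forward rho sigma s -> forward rho (sigma ^+ 2) (sda_step s).
Proof.
move=> r0 s0 us fs p x0 y0 x2 y2 [Dx2 Dy0] le_y2.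
have [x1 [y1 [c1 c2]]] := cell_split x0 y2 us.
have [Ex2 Ey0] := cell_step us c1 c2.
rewrite -{}Dx2 in Ex2; rewrite -{}Dy0 in Ey0.
rewrite Ex2 in c2; rewrite Ey0 in c1.
have [le_x2 le_y1] := fs _ _ _ _ _ c2 le_y2.
have [le_x1 le_y0] := fs _ _ _ _ _ c1 le_y1.
by split=> //; rewrite (le_trans le_x2)// expr2 -mulrA ler_wpM2l.
Qed.

(** The quadratic rate: each step squares the transmission rate. *)
Lemma iter_forward rho m n (s : sda_state R m n) k :
  0 <= rho -> rho < 1 -> contractive rho s ->
  forward rho (rho ^+ (2 ^ k)) (iter k (@sda_step R m n) s) /\
  forward rho (rho ^+ (2 ^ k)) (swap_state (iter k (@sda_step R m n) s)).
Proof.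
move=> r0 r1 cs; elim: k => [|k [fs fs']] /=.
  by split; apply: contractive_forward => //; exact: contractive_swap.
have us := forward_solvable r0 r1 fs fs'.
have us' : step_solvable (swap_state (iter k (@sda_step R m n) s)).
  by case: us.
rewrite expnSr exprM -sda_step_swap.
by split; apply: forward_step; rewrite ?exprn_ge0.
Qed.

Lemma iter_solvable rho m n (s : sda_state R m n) k :
  0 <= rho -> rho < 1 -> contractive rho s ->
  step_solvable (iter k (@sda_step R m n) s).
Proof.
move=> r0 r1 cs; have [fs fs'] := iter_forward k r0 r1 cs.
exact: forward_solvable fs fs'.
Qed.

Lemma cell_mulmxr m n (s : sda_state R m n) p q
    (Z : 'M[R[i]]_(p, q)) x1 y1 x2 y2 :
  @cell _ _ s p x1 y1 x2 y2 ->
  cell s (x1 *m Z) (y1 *m Z) (x2 *m Z) (y2 *m Z).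
Proof. by case=> -> ->; split; rewrite mulmxDl !mulmxA. Qed.

(** If [T] transports the graph of [X] through one cell, its powers transport it
    through the chains. *)
Lemma iter_invariant rho m n (s : sda_state R m n)
    (T : 'M[R[i]]_n) (X : 'M[R[i]]_(m, n)) k :
  0 <= rho -> rho < 1 -> contractive rho s ->
  cell s 1%:M X T (X *m T) ->
  cell (iter k (@sda_step R m n) s) 1%:M X (T ^+ (2 ^ k)) (X *m T ^+ (2 ^ k)).
Proof.
move=> r0 r1 cs cX; elim: k => [|k IH] //=.
apply: (cell_step (iter_solvable k r0 r1 cs) IH).
have := cell_mulmxr (T ^+ (2 ^ k)) IH.
have -> : T ^+ (2 ^ k.+1) = T ^+ (2 ^ k) *m T ^+ (2 ^ k).
  by rewrite expnS mul2n -addnn exprD.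
by rewrite mul1mx -mulmxA.
Qed.

(** The second relation of the invariant cell reads
    [X = H_k + F_k X T ^ (2 ^ k)]. *)
Lemma iter_rate rho m n (s : sda_state R m n)
    (T : 'M[R[i]]_n) (X : 'M[R[i]]_(m, n)) :
  0 <= rho -> rho < 1 -> contractive rho s ->
  cell s 1%:M X T (X *m T) ->
  (forall z, eigenvalue T z -> cabs z < 1) ->
  exists K, forall k,
    cmx_norm (sdaH (iter k (@sda_step R m n) s) - X) <= K * rho ^+ (2 ^ k).
Proof.
move=> r0 r1 cs cX /expmx_bounded[K HK].
exists (n%:R * cmx_norm X * K) => k.
have [_ DX] := iter_invariant k r0 r1 cs cX.
rewrite -cmx_normN opprB {1}DX mulmx1 addrAC subrr add0r.
have [_ fs'] := iter_forward k r0 r1 cs.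
have [le_F _] := forward_decay (X *m T ^+ (2 ^ k)) r0 fs'.
rewrite (le_trans le_F)// mulrC ler_wpM2r ?exprn_ge0//.
by rewrite (le_trans (cmx_normM _ _))// ler_wpM2l ?mulr_ge0 ?cmx_norm_ge0.
Qed.

End Cells.

(** The constant [K] is absorbed by any rate [tau] strictly between [rho] and
    [1], since [K (rho / tau) ^ j] tends to zero. *)
Lemma quadratic_cvg_geometric (R : realType) (p q : nat)
    (U : nat -> 'M[R[i]]_(p, q)) (L : 'M[R[i]]_(p, q)) rho K :
  0 < rho -> rho < 1 ->
  (forall k, cmx_norm (U k - L) <= K * rho ^+ (2 ^ k)) -> quadratic_cvg U L.
Proof.
move=> r0 r1 HU.
have [tau /andP[rt t1]] : exists tau, rho < tau < 1.
  by exists ((rho + 1) / 2); rewrite !midf_lt.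
have t0 : 0 < tau by exact: lt_trans rt.
have [N HN] : exists N, forall k,
    (N <= k)%N -> K * rho ^+ (2 ^ k) <= tau ^+ (2 ^ k).
  have : (K * (rho / tau) ^+ k @[k --> \oo] --> (0 : R))%classic.
    rewrite -[X in (_ --> X)%classic](mulr0 K); apply: cvgMr.
    apply: cvg_expr; rewrite ger0_norm ?divr_ge0 ?ltW//.
    by rewrite ltr_pdivrMr// mul1r.
  move=> /cvgrPdist_lt/(_ 1)/(_ ltr01)[N _ HN].
  exists N => k Nk; have := HN (2 ^ k)%N; rewrite /= sub0r normrN.
  move/(_ (leq_trans Nk (ltnW (ltn_expl _ _)))) => /(_ isT).
  rewrite expr_div_n => /ltW /(le_trans (ler_norm _)).
  by rewrite mulrA ler_pdivrMr ?exprn_gt0// mul1r.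
rewrite /quadratic_cvg.
apply: (@le_lt_trans _ _ tau%:E); last by rewrite lte_fin.
apply: ge_ereal_inf.
exists (ereal_sup [set (cmx_norm (U k - L) `^ (2 ^+ k)^-1)%:E
  | k in [set k | (N <= k)%N]])%classic.
  by exists [set k | (N <= k)%N]%classic => //; exists N.
apply/ereal_supP => _ [k /= Nk <-]; rewrite lee_fin.
have -> : tau = (tau ^+ (2 ^ k)) `^ (2 ^+ k)^-1.
  rewrite -powR_mulrn ?(ltW t0)// -powRrM natrX mulfV ?expf_neq0 ?pnatr_eq0//.
  by rewrite powRr1 ?(ltW t0).
apply: ge0_ler_powR; rewrite ?nnegrE ?cmx_norm_ge0 ?exprn_ge0 ?invr_ge0 //.
  exact: ltW.
exact: le_trans (HU k) (HN k Nk).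
Qed.

(** * Diagonal dominance and the Cayley transform *)

Section Dominance.
Variable R : realType.

Lemma offdiag_sum_ge0 p (Q : 'M[R[i]]_p) i : 0 <= offdiag_sum Q i.
Proof. by apply: sumr_ge0 => j _; exact: cabs_ge0. Qed.

Lemma max_cabs_entry p (z : 'cV[R[i]]_p) :
  z != 0 ->
  exists2 i, 0 < cabs (z i 0) & forall k, cabs (z k 0) <= cabs (z i 0).
Proof.
move=> /matrix0Pn[i0 [j0]]; rewrite (ord1 j0) -cabs_eq0 => z_i0.
case: (@arg_maxP _ _ _ i0 predT (fun k => cabs (z k 0))) => // i _ max_i.
exists i => [|k]; last exact: max_i.
by apply: lt_le_trans (max_i i0 isT); rewrite lt0r z_i0 cabs_ge0.
Qed.

Lemma row_offdiag_le p (Q : 'M[R[i]]_p) (z : 'cV[R[i]]_p) i r :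
  (forall k, cabs (z k 0) <= r) ->
  cabs ((Q *m z) i 0 - Q i i * z i 0) <= offdiag_sum Q i * r.
Proof.
move=> zr; rewrite mxE (bigD1 i)//= addrAC subrr add0r mulr_suml.
apply: le_trans (cabs_sum _ _ _) _; apply: ler_sum => k _.
by rewrite cabsM ler_wpM2l ?cabs_ge0.
Qed.

Definition row_dominant p (Q : 'M[R[i]]_p) :=
  forall i, offdiag_sum Q i < cabs (Q i i).

Lemma row_dominant_unit p (Q : 'M[R[i]]_p) : row_dominant Q -> Q \in unitmx.
Proof.
move=> domQ; apply: unitmx_inj => z Qz0; apply/eqP/negPn/negP => z_neq0.
have [i zi_gt0 max_i] := max_cabs_entry z_neq0.
have := row_offdiag_le Q i max_i.
rewrite Qz0 mxE sub0r cabsN cabsM => le_i.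
by move: le_i; rewrite ler_pM2r// leNgt domQ.
Qed.

Lemma offdiag_sum_shift p (Q : 'M[R[i]]_p) a i :
  offdiag_sum (shift_mx Q a) i = offdiag_sum Q i.
Proof.
apply: eq_bigr => j ji; congr cabs.
by rewrite !mxE eq_sym (negbTE ji) addr0.
Qed.

Lemma shift_diag p (Q : 'M[R[i]]_p) a i : shift_mx Q a i i = a + Q i i.
Proof. by rewrite !mxE eqxx addrC. Qed.

(** At an entry [z] of maximal modulus in a column of [z2], row [k] of the
    equation gives [|a + Q_kk| |z| <= (|a - Q_kk| + q_k) |z1| + q_k |z|]. *)
Lemma cayley_contraction p q (Q : 'M[R[i]]_p) a rho
    (z1 z2 : 'M[R[i]]_(p, q)) :
  0 <= rho -> (forall i, offdiag_sum Q i < cabs (a + Q i i)) ->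
  (forall i, cabs (a - Q i i) + offdiag_sum Q i
    <= rho * (cabs (a + Q i i) - offdiag_sum Q i)) ->
  shift_mx Q a *m z2 = shift_mx Q (- a) *m z1 ->
  cmx_norm z2 <= rho * cmx_norm z1.
Proof.
move=> r0 dom_a rhoP eq_z.
apply: cmx_norm_le => [|i j]; first by rewrite mulr_ge0 ?cmx_norm_ge0.
pose x1 := col j z1; pose x2 := col j z2.
have eq_x : shift_mx Q a *m x2 = shift_mx Q (- a) *m x1.
  by rewrite /x1 /x2 !colE !mulmxA eq_z.
have -> : z2 i j = x2 i 0 by rewrite mxE.
have x1_le k : cabs (x1 k 0) <= cmx_norm z1 by rewrite mxE cabs_le_cmx_norm.
have [->|x2_neq0] := eqVneq x2 0.
  by rewrite mxE cabs0 mulr_ge0 ?cmx_norm_ge0.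
have [k _ max_k] := max_cabs_entry x2_neq0.
apply: le_trans (max_k i) _.
have le2 := row_offdiag_le (shift_mx Q a) k max_k.
have le1 := row_offdiag_le (shift_mx Q (- a)) k x1_le.
rewrite !offdiag_sum_shift !shift_diag in le1 le2.
have : cabs ((a + Q k k) * x2 k 0) <= cabs ((- a + Q k k) * x1 k 0)
   + offdiag_sum Q k * cmx_norm z1 + offdiag_sum Q k * cabs (x2 k 0).
  rewrite eq_x in le2.
  set X := (_ *m _) k 0 in le1 le2.
  have -> : (a + Q k k) * x2 k 0 = (- a + Q k k) * x1 k 0
     + (X - (- a + Q k k) * x1 k 0) - (X - (a + Q k k) * x2 k 0) by ring.
  by rewrite (le_trans (cabsB _ _))// lerD// (le_trans (cabsD _ _))// lerD2l.
rewrite !cabsM -(cabsN (- a + Q k k)) opprD opprK.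
have := cabs_ge0 (a - Q k k); have := rhoP k; have := dom_a k.
have := x1_le k; have := cmx_norm_ge0 z1.
move: (cabs (a - Q k k)) (cabs (a + Q k k)) (offdiag_sum Q k) => b c q0.
move: (cmx_norm z1) (cabs (x1 k 0)) (cabs (x2 k 0)) => N u v.
move=> N0 uN qc bq b0 H.
rewrite -(@ler_pM2l _ (c - q0)) ?subr_gt0//.
have : b * u <= b * N by rewrite ler_wpM2l.
have : (b + q0) * N <= rho * (c - q0) * N by rewrite ler_wpM2r.
lra.
Qed.

Definition omega_dominant w p (Q : 'M[R[i]]_p) :=
  forall i, offdiag_sum Q i < omega_part w (Q i i).

Lemma omega_comparison_dominant w p (Q : 'M[R[i]]_p) :
  pos_colvec (omega_comparison w Q *m (const_mx 1 : 'cV[R]_p)) ->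
  omega_dominant w Q.
Proof.
move=> Q1 i; have := Q1 i; rewrite mxE (bigD1 i)//= !mxE eqxx mulr1.
rewrite (eq_bigr (fun j => - cabs (Q i j))) => [|j ji].
  by rewrite sumrN subr_gt0.
by rewrite !mxE eq_sym (negbTE ji) mulr1.
Qed.

(** The equation is [(Q + diag d) z = 0]: a row where [omega(d_j) >= 0] is
    strictly dominant, hence cannot carry the largest entry of [z]. *)
Lemma argmax_omega_lt0 w p (Q : 'M[R[i]]_p) (d : 'I_p -> R[i])
    (z : 'cV[R[i]]_p) :
  0 <= w -> w <= 1 -> omega_dominant w Q -> z != 0 ->
  (forall i, (Q *m z) i 0 = - (d i * z i 0)) ->
  exists2 j, omega_part w (d j) < 0 & forall i, cabs (z i 0) <= cabs (z j 0).
Proof.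
move=> w0 w1 domQ z_neq0 Qz; have [j zj_gt0 max_j] := max_cabs_entry z_neq0.
exists j => //; rewrite ltNge; apply/negP => dj_ge0.
have := row_offdiag_le Q j max_j.
rewrite Qz -opprD cabsN -mulrDl cabsM ler_pM2r// leNgt => /negP; apply.
rewrite (lt_le_trans (domQ j))// (le_trans _ (omega_part_le_cabs _ w0 w1))//.
by rewrite omega_partD lerDr.
Qed.

(** This is what makes the Cayley transform of [Q] at [a] contractive: one
    off-diagonal sum comes from [Q + a] and the other one from [Q - a]. *)
Definition cayley_dominant (a : R[i]) p (Q : 'M[R[i]]_p) :=
  forall i, cabs (a - Q i i) + 2 * offdiag_sum Q i < cabs (a + Q i i).

Lemma uniform_ratio (I : finType) (f g : I -> R) :
  (forall i, f i < g i) -> (forall i, 0 < g i) ->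
  exists2 rho, 0 < rho < 1 & forall i, f i <= rho * g i.
Proof.
move=> fg g0.
(* The default value 1/2 keeps the maximum positive and below 1. *)
exists (\big[Num.max/2^-1]_i (f i / g i)) => [|i].
  apply/andP; split.
    by apply: lt_le_trans (bigmax_ge_id _ _ _ _); rewrite invr_gt0.
  apply: bigmax_lt => [|i _]; first by rewrite invf_lt1// ltr1n.
  by rewrite ltr_pdivrMr ?mul1r.
by rewrite -ler_pdivrMr// le_bigmax.
Qed.

Lemma cayley_dominant_rate a p (Q : 'M[R[i]]_p) :
  cayley_dominant a Q ->
  exists2 rho, 0 < rho < 1 & forall i,
    cabs (a - Q i i) + offdiag_sum Q i
      <= rho * (cabs (a + Q i i) - offdiag_sum Q i).
Proof.
move=> dom; apply: uniform_ratio => i; have := dom i;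
  have := offdiag_sum_ge0 Q i; have := cabs_ge0 (a - Q i i); lra.
Qed.

Lemma cayley_dominant_shift a p (Q : 'M[R[i]]_p) i :
  cayley_dominant a Q -> offdiag_sum Q i < cabs (a + Q i i).
Proof.
move=> /(_ i); have := offdiag_sum_ge0 Q i; have := cabs_ge0 (a - Q i i); lra.
Qed.

(** Clearing the denominator, the hypothesis reads
    [q_i (|a + Q_ii| + |a - Q_ii|) < omega(a) (|a + Q_ii| - |a - Q_ii|)], and
    [|a + Q_ii| + |a - Q_ii| >= |2 a| >= 2 omega(a)]. *)
Lemma parameter_cayley_dominant w a p (Q : 'M[R[i]]_p) :
  0 <= w -> w <= 1 -> 0 < omega_part w a -> omega_dominant w Q ->
  (forall i, (omega_part w a + offdiag_sum Q i) / cabs (a + Q i i)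
       * cabs (a - Q i i) < omega_part w a - offdiag_sum Q i) ->
  cayley_dominant a Q.
Proof.
move=> w0 w1 a0 domQ Ha i; have := Ha i; have := offdiag_sum_ge0 Q i.
have c_gt0 : 0 < cabs (a + Q i i).
  rewrite (lt_le_trans _ (omega_part_le_cabs _ w0 w1))// omega_partD.
  by rewrite addr_gt0// (le_lt_trans (offdiag_sum_ge0 Q i)).
have bc : 2 * omega_part w a <= cabs (a + Q i i) + cabs (a - Q i i).
  apply: le_trans (cabsD _ _).
  rewrite (le_trans _ (omega_part_le_cabs _ w0 w1))//.
  have -> : a + Q i i + (a - Q i i) = a + a by ring.
  by rewrite omega_partD; lra.
move=> q0; rewrite mulrAC ltr_pdivrMr// => H.
have q_nneg : offdiag_sum Q i * (2 * omega_part w a)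
   <= offdiag_sum Q i * (cabs (a + Q i i) + cabs (a - Q i i)).
  by rewrite ler_wpM2l.
rewrite -(ltr_pM2l a0); lra.
Qed.

End Dominance.

(** * The coefficient matrix and its blocks *)

Section Blocks.
Variable R : realType.

Lemma offdiag_sum_lshift n m (M : 'M[R[i]]_n) (N : 'M[R[i]]_(n, m)) P S i :
  offdiag_sum (block_mx M N P S : 'M[R[i]]_(n + m)) (lshift m i)
    = offdiag_sum M i + \sum_j cabs (N i j).
Proof.
rewrite /offdiag_sum big_split_ord /=; congr (_ + _).
  by apply: eq_big => j; rewrite ?eq_lshift// block_mxEul.
by apply: eq_big => j; rewrite ?eq_rlshift// block_mxEur.
Qed.

Lemma offdiag_sum_rshift n m (M : 'M[R[i]]_n) N (P : 'M[R[i]]_(m, n)) S i :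
  offdiag_sum (block_mx M N P S : 'M[R[i]]_(n + m)) (rshift n i)
    = \sum_j cabs (P i j) + offdiag_sum S i.
Proof.
rewrite /offdiag_sum big_split_ord /=; congr (_ + _).
  by apply: eq_big => j; rewrite ?eq_lrshift// block_mxEdl.
by apply: eq_big => j; rewrite ?eq_rshift// block_mxEdr.
Qed.

(** The coefficient matrix of the dual equation is that of the primal one with
    the two groups of indices exchanged, so row conditions carry over. *)
Lemma coeff_mx_dual (P : R[i] -> R -> Prop) m n (A : 'M[R[i]]_m)
    (B : 'M[R[i]]_(m, n)) (C : 'M[R[i]]_(n, m)) (D : 'M[R[i]]_n) :
  (forall i, P (coeff_mx A B C D i i) (offdiag_sum (coeff_mx A B C D) i)) ->
  forall i, P (coeff_mx D C B A i i) (offdiag_sum (coeff_mx D C B A) i).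
Proof.
move=> HP i; rewrite /coeff_mx; case: (split_ordP i) => j ->.
  have := HP (rshift n j).
  by rewrite offdiag_sum_lshift offdiag_sum_rshift block_mxEul block_mxEdr addrC.
have := HP (lshift m j).
by rewrite offdiag_sum_lshift offdiag_sum_rshift block_mxEul block_mxEdr addrC.
Qed.

Lemma shift_mulmx n p (M : 'M[R[i]]_n) a (x : 'M[R[i]]_(n, p)) :
  shift_mx M a *m x = M *m x + a *: x.
Proof. by rewrite mulmxDl mul_scalar_mx. Qed.

Lemma shift_block m n (A : 'M[R[i]]_m) (B : 'M[R[i]]_(m, n))
    (C : 'M[R[i]]_(n, m)) (D : 'M[R[i]]_n) a :
  shift_mx (coeff_mx A B C D) a
    = block_mx (shift_mx D a) (- C) (- B) (shift_mx A a).
Proof. by rewrite /shift_mx scalar_mx_block add_block_mx !addr0. Qed.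

End Blocks.

(** * The initial state and the closed-loop matrix *)

Section Initial.
Variables (R : realType) (m n : nat).
Variables (A : 'M[R[i]]_m) (B : 'M[R[i]]_(m, n)) (C : 'M[R[i]]_(n, m)).
Variables (D : 'M[R[i]]_n) (a : R[i]).
Let Q := coeff_mx A B C D.
Hypothesis dom : cayley_dominant a Q.

Lemma cayley_unit_Q : shift_mx Q a \in unitmx.
Proof.
apply: row_dominant_unit => i.
by rewrite offdiag_sum_shift shift_diag cayley_dominant_shift.
Qed.

Lemma cayley_unit_D : shift_mx D a \in unitmx.
Proof.
apply: row_dominant_unit => i; rewrite offdiag_sum_shift shift_diag.
have := cayley_dominant_shift (lshift m i) dom.
rewrite offdiag_sum_lshift block_mxEul; apply: le_lt_trans.
by rewrite lerDl sumr_ge0// => j _; exact: cabs_ge0.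
Qed.

Lemma cayley_unit_A : shift_mx A a \in unitmx.
Proof.
apply: row_dominant_unit => i; rewrite offdiag_sum_shift shift_diag.
have := cayley_dominant_shift (rshift n i) dom.
rewrite offdiag_sum_rshift block_mxEdr; apply: le_lt_trans.
by rewrite lerDr sumr_ge0// => j _; exact: cabs_ge0.
Qed.

(** [W] and, below, [V] are the Schur complements of [Q + a]. *)
Lemma cayley_unit_W : sda_W A B C D a a \in unitmx.
Proof.
apply: unitmx_inj => x Wx0.
pose u := invmx (shift_mx D a) *m C *m x.
have : shift_mx Q a *m col_mx u x = 0.
  rewrite shift_block mul_block_col /u !mulNmx -!mulmxA mulKVmx ?cayley_unit_D//.
  move: Wx0; rewrite /sda_W mulmxBl -!mulmxA => Wx0.
  by rewrite subrr addrC Wx0 col_mx0.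
move/(congr1 (mulmx (invmx (shift_mx Q a)))).
rewrite mulKmx ?cayley_unit_Q// mulmx0 => /eqP.
by rewrite col_mx_eq0 => /andP[_ /eqP].
Qed.

Lemma cayley_unit_V : sda_V A B C D a a \in unitmx.
Proof.
apply: unitmx_inj => x Vx0.
pose u := invmx (shift_mx A a) *m B *m x.
have : shift_mx Q a *m col_mx x u = 0.
  rewrite shift_block mul_block_col /u !mulNmx -!mulmxA mulKVmx ?cayley_unit_A//.
  move: Vx0; rewrite /sda_V mulmxBl -!mulmxA => ->.
  by rewrite addrC subrr col_mx0.
move/(congr1 (mulmx (invmx (shift_mx Q a)))).
rewrite mulKmx ?cayley_unit_Q// mulmx0 => /eqP.
by rewrite col_mx_eq0 => /andP[/eqP].
Qed.

Let s := sda_init A B C D a a.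

Lemma invW_B : invmx (sda_W A B C D a a) *m B *m invmx (shift_mx D a)
  = invmx (shift_mx A a) *m B *m invmx (sda_V A B C D a a).
Proof.
apply: (canRL (mulmxK cayley_unit_V)).
rewrite -!mulmxA; apply: (canLR (mulKmx cayley_unit_W)).
rewrite /sda_W /sda_V !(mulmxBl, mulmxBr) !mulmxA.
by rewrite mulmxV ?mulmxKV ?mul1mx ?cayley_unit_A ?cayley_unit_D.
Qed.

Lemma invV_C : invmx (sda_V A B C D a a) *m C *m invmx (shift_mx A a)
  = invmx (shift_mx D a) *m C *m invmx (sda_W A B C D a a).
Proof.
apply: (canRL (mulmxK cayley_unit_W)).
rewrite -!mulmxA; apply: (canLR (mulKmx cayley_unit_V)).
rewrite /sda_W /sda_V !(mulmxBl, mulmxBr) !mulmxA.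
by rewrite mulmxV ?mulmxKV ?mul1mx ?cayley_unit_A ?cayley_unit_D.
Qed.

(** The signs come from [Q + a] having off-diagonal blocks [- C] and [- B]. *)
Lemma init_cell_cayley p (x1 : 'M[R[i]]_(n, p)) y1 x2 y2 :
  cell s x1 y1 x2 y2 ->
  shift_mx Q a *m col_mx x2 (- y1) = shift_mx Q (- a) *m col_mx x1 (- y2).
Proof.
have EH1 : shift_mx D a *m sdaE s + C *m sdaH s = shift_mx D (- a).
  rewrite /= invW_B mulmxBr mulmx1 -!scalemxAr !mulmxA -addrA.
  rewrite [- _ + _]addrC -[(a + a) *: _ - _]opprB -scalerBr -mulmxBl.
  rewrite mulmxV ?cayley_unit_V//.
  by rewrite scalemx1 /shift_mx raddfN raddfD /= opprD addrA addrK.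
have GF1 : shift_mx D a *m sdaG s + C *m sdaF s = C.
  rewrite /= mulmxBr mulmx1 -!scalemxAr !mulmxA mulmxV ?cayley_unit_D//.
  by rewrite mul1mx addrC subrK.
have EH2 : B *m sdaE s + shift_mx A a *m sdaH s = B.
  rewrite /= invW_B mulmxBr mulmx1 -!scalemxAr !mulmxA mulmxV ?cayley_unit_A//.
  by rewrite mul1mx subrK.
have GF2 : B *m sdaG s + shift_mx A a *m sdaF s = shift_mx A (- a).
  rewrite /= mulmxBr mulmx1 -!scalemxAr !mulmxA addrCA.
  rewrite -[(a + a) *: _ - _]opprB -scalerBr -mulmxBl mulmxV ?cayley_unit_W//.
  by rewrite scalemx1 /shift_mx raddfN raddfD /= opprD addrA addrK.
case=> -> ->; rewrite !shift_block !mul_block_col !mulNmx !mulmxN !opprK.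
rewrite !mulmxDr !mulmxA; congr col_mx.
  by rewrite addrACA -!mulmxDl EH1 GF1.
rewrite -!opprD; congr (- _).
by rewrite addrACA -!mulmxDl EH2 GF2.
Qed.

Lemma cayley_init_cell p (x1 : 'M[R[i]]_(n, p)) y1 x2 y2 :
  shift_mx Q a *m col_mx x2 (- y1) = shift_mx Q (- a) *m col_mx x1 (- y2) ->
  cell s x1 y1 x2 y2.
Proof.
rewrite -(init_cell_cayley (conj erefl erefl)).
move/(congr1 (mulmx (invmx (shift_mx Q a)))); rewrite !mulKmx ?cayley_unit_Q//.
by case/eq_col_mx => -> /oppr_inj ->.
Qed.

Lemma init_contractive rho :
  0 <= rho ->
  (forall i, cabs (a - Q i i) + offdiag_sum Q i
      <= rho * (cabs (a + Q i i) - offdiag_sum Q i)) ->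
  contractive rho s.
Proof.
move=> r0 rhoP p x1 y1 x2 y2 /init_cell_cayley.
move/(cayley_contraction r0 (fun i => cayley_dominant_shift i dom) rhoP).
by rewrite !cmx_norm_col !cmx_normN.
Qed.

Lemma sda_init_dual : sda_init D C B A a a = swap_state s.
Proof.
rewrite /sda_init /swap_state /= -/(sda_V A B C D a a) -/(sda_W A B C D a a).
by rewrite invW_B invV_C.
Qed.

Variables (w : R) (Phi : 'M[R[i]]_(m, n)).
Hypotheses (w0 : 0 <= w) (w1 : w <= 1) (a0 : 0 < omega_part w a).
Hypothesis domQ : omega_dominant w Q.
Hypothesis HPhi : extremal_solution w A B C D Phi.
Let S := D - C *m Phi.
Let T := invmx (shift_mx S a) *m shift_mx S (- a).

(** The Riccati equation as an invariance of the graph of [Phi]. *)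
Lemma closed_loop_intertwine : Phi *m S = B - A *m Phi.
Proof.
case: HPhi => /eqP; rewrite /riccati_solution /S mulmxBr mulmxA => ric _.
apply/eqP; rewrite eq_sym -subr_eq0 opprB [X in X == _]addrC addrA.
by rewrite [X in X == _]addrAC.
Qed.

(** [- a] has negative omega-part, so it is not an eigenvalue of [S]. *)
Lemma closed_loop_unit : shift_mx S a \in unitmx.
Proof.
apply: unitmx_inj => x; rewrite mulmxDl mul_scalar_mx => /eqP.
rewrite addr_eq0 -scaleNr => /eqP Sx; apply/eqP/negPn/negP => x_neq0.
have [_ /(_ (- a))] := HPhi.
have -> : eigenvalue (D - C *m Phi) (- a) by apply/eigenvalue_colP; exists x.
move=> /(_ isT); apply/negP; rewrite -leNgt.
have : omega_part w (- a) + omega_part w a = 0.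
  by rewrite -omega_partD addNr /omega_part /= !mulr0 addr0.
by move: a0; lra.
Qed.

Lemma cayley_TE : shift_mx S a *m T = shift_mx S (- a).
Proof. by rewrite /T mulKVmx ?closed_loop_unit. Qed.

Lemma closed_loop_cell : cell s 1%:M Phi T (Phi *m T).
Proof.
apply: cayley_init_cell.
rewrite !shift_block !mul_block_col !mulNmx !mulmxN !opprK !mulmx1.
have ST : S *m T = S - a%:M - a *: T.
  apply/eqP; rewrite eq_sym subr_eq -mul_scalar_mx -mulmxDl -/(shift_mx S a).
  by rewrite cayley_TE /shift_mx raddfN.
have DE : D = S + C *m Phi by rewrite subrK.
have BE : B = Phi *m S + A *m Phi by rewrite closed_loop_intertwine subrK.
have BT : B *m T = Phi *m S - a *: Phi - a *: (Phi *m T) + A *m (Phi *m T).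
  rewrite BE mulmxDl -!mulmxA ST !mulmxBr -scalemxAr.
  by rewrite mul_mx_scalar.
have DT : D *m T = S - a%:M - a *: T + C *m (Phi *m T).
  by rewrite {1}DE mulmxDl ST mulmxA.
rewrite /shift_mx !raddfN /= !mulmxDl !mulNmx !mul_scalar_mx BT DT BE DE.
(* Once the products are generalized, both block rows are linear identities,
   valid entry by entry. *)
move: (C *m Phi) (C *m (Phi *m T)) (Phi *m S) (A *m Phi) (A *m (Phi *m T)).
move: (Phi *m T) T S => U V M X1 X2 X3 X4 X5.
by congr col_mx; apply/matrixP => i j; rewrite !mxE; ring.
Qed.

(** The eigenvalue [l = a (1 + z) / (1 - z)] of [S] attached to [z] has positive
    omega-part, whence [|Phi x| <= |x|] for the eigenvector [x]; through the
    initial cell, [|z| |x| <= rho max(|x|, |z| |Phi x|)], which is less than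
    [|z| |x|] if [|z| >= 1]. *)
Lemma closed_loop_eigenvalue rho z :
  0 <= rho -> rho < 1 -> contractive rho s -> eigenvalue T z -> cabs z < 1.
Proof.
move=> r0 r1 cs /eigenvalue_colP[x Tx x_neq0]; rewrite ltNge; apply/negP => z1.
have : (1 - z) *: (S *m x) = (a * (1 + z)) *: x.
  have := congr1 (mulmx^~ x) cayley_TE.
  rewrite /= -mulmxA Tx -scalemxAr !shift_mulmx; move: (S *m x) => y E1.
  apply/matrixP => i j; have := congr1 (fun M : 'cV_n => M i j) E1.
  rewrite !mxE => E2; rewrite mulrBl mul1r.
  have {1}-> : y i j = z * (y i j + a * x i j) + a * x i j by rewrite E2; ring.
  by ring.
have [->|z_neq1] := eqVneq z 1.
  rewrite subrr scale0r => /esym/eqP; rewrite scalemx_eq0 (negbTE x_neq0) orbF.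
  rewrite mulf_eq0 -[1 + 1]/(2%:R) pnatr_eq0 orbF => /eqP aE; move: a0.
  by rewrite aE /omega_part /= !mulr0 addr0 ltxx.
have z1_neq0 : 1 - z != 0 by rewrite subr_eq0 eq_sym.
pose l := (1 - z)^-1 * (a * (1 + z)).
move=> /(congr1 (GRing.scale (1 - z)^-1)).
rewrite !scalerA mulVf// scale1r -/l => Sx.
have l_pos : 0 < omega_part w l.
  by case: HPhi => _; apply; apply/eigenvalue_colP; exists x.
(* [Q (x, Phi x) = (l x, - l Phi x)]: only the first block has a diagonal
   correction of negative omega-part. *)
pose d (i : 'I_(n + m)) := if fintype.split i is inl _ then - l else l.
pose v : 'cV[R[i]]_(n + m) := col_mx x (Phi *m x).
have v_neq0 : v != 0.
  by rewrite col_mx_eq0 negb_and x_neq0.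
have Qv i : (Q *m v) i 0 = - (d i * v i 0).
  have PSx : Phi *m (S *m x) = B *m x - A *m (Phi *m x).
    by rewrite mulmxA closed_loop_intertwine mulmxBl mulmxA.
  rewrite Sx -scalemxAr in PSx; rewrite /S mulmxBl -mulmxA in Sx.
  rewrite /Q /v /coeff_mx mul_block_col !mulNmx Sx addrC -opprB -PSx /d.
  by case: (split_ordP i) => j ->; rewrite ?(col_mxEu, col_mxEd) !mxE;
    rewrite ?mulNr ?opprK.
have [j dj max_j] := argmax_omega_lt0 w0 w1 domQ v_neq0 Qv.
have le_Phix : cmx_norm (Phi *m x) <= cmx_norm x.
  move: dj max_j; rewrite /d /v; case: (split_ordP j) => k -> dk max_k; last lra.
  apply: cmx_norm_le => [|i i']; first exact: cmx_norm_ge0.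
  rewrite (ord1 i'); have := max_k (rshift n i); rewrite col_mxEu col_mxEd.
  by move/le_trans; apply; exact: cabs_le_cmx_norm.
have := cs _ _ _ _ _ (cell_mulmxr x closed_loop_cell).
rewrite mul1mx -mulmxA Tx -scalemxAr !cmx_normZ ge_max => /andP[+ _].
have x_gt0 : 0 < cmx_norm x.
  by rewrite ltNge; apply: contra x_neq0 => /cmx_norm_le0 ->.
apply/negP; rewrite -ltNge.
have zx : cmx_norm x <= cabs z * cmx_norm x by rewrite ler_peMl ?cmx_norm_ge0.
have le_max : Num.max (cmx_norm x) (cabs z * cmx_norm (Phi *m x))
    <= cabs z * cmx_norm x.
  by rewrite ge_max zx ler_wpM2l ?cabs_ge0.
rewrite (le_lt_trans (ler_wpM2l r0 le_max))// gtr_pMl//.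
exact: lt_le_trans x_gt0 zx.
Qed.

Lemma sda_primal_cvg :
  sda_well_defined A B C D a /\
  quadratic_cvg (fun k => sdaH (sda A B C D a k)) Phi.
Proof.
have [rho /andP[r0 r1] rhoP] := cayley_dominant_rate dom.
have cs := init_contractive (ltW r0) rhoP.
split.
  split; first exact: cayley_unit_A.
  - exact: cayley_unit_D.
  - exact: cayley_unit_W.
  - exact: cayley_unit_V.
  - by move=> k; exact: iter_solvable k (ltW r0) r1 cs.
have [K HK] := iter_rate (ltW r0) r1 cs closed_loop_cell
  (fun z => closed_loop_eigenvalue (ltW r0) r1 cs).
exact: quadratic_cvg_geometric HK.
Qed.

End Initial.

Theorem theorem6p3 (R : realType) (m n : nat) (w : R)
    (A : 'M[R[i]]_m) (B : 'M[R[i]]_(m, n)) (C : 'M[R[i]]_(n, m))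
    (D : 'M[R[i]]_n) (Phi : 'M[R[i]]_(m, n)) (Psi : 'M[R[i]]_(n, m))
    (alpha : R[i])
    (w_ge0 : 0 <= w) (w_le1 : w <= 1)
    (HH : class_H w A B C D)
    (HQ1 : pos_colvec
      (omega_comparison w (coeff_mx A B C D) *m (const_mx 1 : 'cV[R]_(n + m))))
    (HPhi : extremal_solution w A B C D Phi)
    (HPsi : extremal_solution w D C B A Psi)
    (alpha_pos : 0 < omega_part w alpha)
    (Halpha : forall i : 'I_(n + m),
      let Qii := coeff_mx A B C D i i in
      let qi := offdiag_sum (coeff_mx A B C D) i in
      (omega_part w alpha + qi) / cabs (alpha + Qii) * cabs (alpha - Qii)
        < omega_part w alpha - qi) :
  sda_well_defined A B C D alpha /\
  quadratic_cvg (fun k => sdaH (sda A B C D alpha k)) Phi /\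
  quadratic_cvg (fun k => sdaG (sda A B C D alpha k)) Psi.
Proof.
have domQ := omega_comparison_dominant HQ1.
have dom := parameter_cayley_dominant w_ge0 w_le1 alpha_pos domQ Halpha.
have domQ' : omega_dominant w (coeff_mx D C B A).
  exact: (coeff_mx_dual (P := fun z q => q < omega_part w z)) domQ.
have dom' : cayley_dominant alpha (coeff_mx D C B A).
  exact: (coeff_mx_dual
    (P := fun z q => cabs (alpha - z) + 2 * q < cabs (alpha + z))) dom.
have [wd cvgH] := sda_primal_cvg dom w_ge0 w_le1 alpha_pos domQ HPhi.
have [_ cvgG] := sda_primal_cvg dom' w_ge0 w_le1 alpha_pos domQ' HPsi.
split; [exact: wd | split; [exact: cvgH|]].
have sdaE k : sda D C B A alpha k = swap_state (sda A B C D alpha k).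
  rewrite /sda /doubling (sda_init_dual dom).
  by elim: k => [//|k IH]; rewrite !iterS IH sda_step_swap.
have -> : (fun k => sdaG (sda A B C D alpha k))
    = (fun k => sdaH (sda D C B A alpha k)).
  by apply/funext => k; rewrite sdaE; move: (sda A B C D alpha k).
exact: cvgG.
Qed.
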